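(* The floor function $x\mapsto\lfloor x\rfloor$ is the only function $f:\mathbb{R}\rightarrow\mathbb{R}$ satisfying all of the following conditions (that is, the floor function satisfies them, and any $f:\mathbb{R}\to\mathbb{R}$ satisfying them equals the floor function): (1) $f(x-f(x)+f(y))=f(y)$ for all $x,y\in\mathbb{R}$; (2) the range of the function $x\mapsto x-f(x)$ (on $\mathbb{R}$) is $[0,1)$; (3) $f(0)=0$.
   Context: $\lfloor x\rfloor$ denotes the greatest integer less than or equal to the real number $x$, regarded as a function $\mathbb{R}\to\mathbb{R}$. *)

(* Defs.v *)
From mathcomp Require Import all_boot all_order all_algebra.
From mathcomp Require Import classical_sets set_interval reals.

Set Implicit Arguments.
Unset Strict Implicit.
Unset Printing Implicit Defensive.

Import Order.TTheory GRing.Theory Num.Theory.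
Local Open Scope classical_set_scope.
Local Open Scope ring_scope.

Definition floor_conditions (R : realType) (f : R -> R) : Prop :=
  [/\ forall x y : R, f (x - f x + f y) = f y,
      range (fun x : R => x - f x) = `[0, 1[%classic
    & f 0 = 0].

(* Main.v *)
Require Import Defs.
From mathcomp Require Import all_boot all_order all_algebra.
From mathcomp Require Import classical_sets set_interval reals.
From mathcomp Require Import boolp lra.

(** Since [x - f x] takes every value in [0, 1[, condition (1) says that [f] is
constantly [s] on [s, s + 1[ for every [s] in the range of [f]; as
[f x <= x < f x + 1], these intervals tile the line.  The intervals being
half-open of length 1, the next and the previous tile start at [s + 1] and
[s - 1], so condition (3) makes every integer the left end of a tile. *)

Import Order.TTheory GRing.Theory Num.Theory.
Local Open Scope ring_scope.

Lemma Rfloor_floor_conditions (R : realType) : floor_conditions (@Rfloor R).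
Proof.
split=> [x y||]; last exact: Rfloor0.
(* Only the right-hand side becomes an integer cast, the form [range1zP] needs. *)
- rewrite {2}(RfloorE y); apply/range1zP; rewrite -RfloorE /range1 /mkset.
  by have := Rfloor_le x; have := lt_succ_Rfloor x; lra.
- apply/seteqP; split=> t /=.
  + case=> x _ <-; rewrite in_itv /=.
    by have := Rfloor_le x; have := lt_succ_Rfloor x; lra.
  + rewrite in_itv /= => t01; exists t => //.
    suff -> : Rfloor t = 0 by rewrite subr0.
    by apply/(range1zP 0); rewrite /range1 /mkset /= add0r.
Qed.

Section Tiling.
Variables (R : realType) (f : R -> R).
Hypothesis fP : floor_conditions f.

Lemma floor_conditions_itv x : f x <= x < f x + 1.
Proof.
case: fP => _ rg _.
have : `[0, 1[%classic (x - f x) by rewrite -rg; exists x.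
by rewrite /= in_itv /=; lra.
Qed.

Lemma floor_conditions_tile x y : f y <= x < f y + 1 -> f x = f y.
Proof.
case: fP => f1 rg _ xy.
have : `[0, 1[%classic (x - f y) by rewrite /= in_itv /=; lra.
by rewrite -rg => -[z _ zE]; rewrite -(f1 z y) zE subrK.
Qed.

(** Otherwise [f (s + 1)] would lie in the tile of [s], strictly to the right of [s]; being a fixed
    point of [f], it would equal [s]. *)
Lemma floor_conditions_succ s : f s = s -> f (s + 1) = s + 1.
Proof.
move=> fs; have /andP[le_f lt_f] := floor_conditions_itv (s + 1).
have [lt_fs|] := ltP (f (s + 1)) (s + 1); last by lra.
have ffs : f (f (s + 1)) = f (s + 1) by apply: floor_conditions_tile; lra.
have : f (f (s + 1)) = f s by apply: floor_conditions_tile; rewrite fs; lra.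
by lra.
Qed.

(** The tile of [s - 1] starts at the fixed point [f (s - 1)], so the next one starts at
    [f (s - 1) + 1] and contains [s], itself a start. *)
Lemma floor_conditions_pred s : f s = s -> f (s - 1) = s - 1.
Proof.
move=> fs; have /andP[le_f lt_f] := floor_conditions_itv (s - 1).
have ffs : f (f (s - 1)) = f (s - 1) by apply: floor_conditions_tile; lra.
have fS := floor_conditions_succ _ ffs.
have : f s = f (f (s - 1) + 1) by apply: floor_conditions_tile; rewrite fS; lra.
by lra.
Qed.

Lemma floor_conditions_int (n : int) : f n%:~R = n%:~R.
Proof.
elim/int_ind: n => [|n IHn|n IHn]; first by case: fP.
- by rewrite -addn1 PoszD rmorphD /= floor_conditions_succ.
- by rewrite -addn1 PoszD opprD rmorphD /= floor_conditions_pred.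
Qed.

End Tiling.

Theorem theorem2p1 (R : realType) :
  floor_conditions (@Rfloor R) /\
  forall f : R -> R, floor_conditions f -> f = @Rfloor R.
Proof.
split=> [|f fP]; first exact: Rfloor_floor_conditions.
(* With the floor of [x] written as its own image under [f], it remains to see that [x] lies in the
   tile starting there. *)
apply/funext => x; rewrite RfloorE -(floor_conditions_int _ _ fP).
apply: (floor_conditions_tile _ _ fP); rewrite (floor_conditions_int _ _ fP) -RfloorE.
by rewrite Rfloor_le lt_succ_Rfloor.
Qed.
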